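(* Let $I$ be any instance of Max d-KP. The following conditions are equivalent: (1) $I$ has an equivalent graph; (2) $I$ satisfies property $P_d(I)$; (3) $I$ is equivalent to the graph $G_d(I)$; (4) $I$ has an equivalent $d$-threshold graph.
   Context: Max d-KP: an instance consists of a set $A=\{a_1,\ldots,a_n\}$ of $n$ items and a positive integer $d$ of dimensions. Each item $a_j$ has a non-negative real profit $p_j$ and, for each dimension $i\in\{1,\ldots,d\}$, a non-negative real size $s_{i,j}$. For each dimension $i$ there is a non-negative real capacity $c_i$. A subset $A'\subseteq A$ is a feasible solution if $\sum_{a_j\in A'}s_{i,j}\le c_i$ for every $i$. The task is to find a feasible solution of maximum total profit. An instance $I$ and a finite simple graph $G=(V,E)$ are equivalent if there is a bijection $f:A\to V$ such that $A'\subseteq A$ is feasible for $I$ if and only if $f(A')$ is an independent set of $G$. Property $P_d(I)$: for every $A'\subseteq A$, if $s_{i,j}+s_{i,j'}\le c_i$ for every $i\in\{1,\ldots,d\}$ and all distinct $a_j,a_{j'}\in A'$, then $\sum_{a_j\in A'}s_{i,j}\le c_i$ for every $i$. $G_d(I)$ has vertex set $\{v_j: a_j\in A\}$, and $\{v_j,v_{j'}\}$ ($j\ne j'$) is an edge if and only if $s_{i,j}+s_{i,j'}>c_i$ for some $i\in\{1,\ldots,d\}$. A threshold graph is a graph $H=(V,F)$ for which there exist non-negative reals $w_v$ and $T$ with $U\subseteq V$ independent if and only if $\sum_{v\in U}w_v\le T$. A graph $G=(V,E)$ is $d$-threshold if there are at most $d$ threshold graphs $G_i=(V,E_i)$ with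 $E=E_1\cup\cdots\cup E_d$. Equivalently, there are at most $d$ linear inequalities $\sum_j a_{i,j}x_j\le T_i$ whose common 0/1 solutions are exactly the characteristic vectors of independent sets of $G$. *)

(* Defs.v *)
From mathcomp Require Import all_boot all_order all_algebra.
From mathcomp Require Import reals.

Set Implicit Arguments.
Unset Strict Implicit.
Unset Printing Implicit Defensive.

Import Order.TTheory GRing.Theory Num.Theory.

Local Open Scope ring_scope.

(* Items and dimensions are indexed from 0: a_1, ..., a_n are the elements of
   'I_n, and sz i j is s_{i,j}.  A theorem about instances must assume 0 < d. *)
Record dKP (R : realType) (n d : nat) := DKP {
  profit : 'I_n -> R;
  sz : 'I_d -> 'I_n -> R;
  cap : 'I_d -> R;
  profit_ge0 : forall j, 0 <= profit j;
  sz_ge0 : forall i j, 0 <= sz i j;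
  cap_ge0 : forall i, 0 <= cap i
}.

Definition feasible (R : realType) (n d : nat) (I : dKP R n d)
    (A : {set 'I_n}) : Prop :=
  forall i, \sum_(j in A) sz I i j <= cap I i.

Record sgraph (V : finType) := SGraph {
  adj : rel V;
  adj_sym : symmetric adj;
  adj_irrefl : irreflexive adj
}.

Definition independent (V : finType) (G : sgraph V) (U : {set V}) : Prop :=
  forall u v, u \in U -> v \in U -> ~~ adj G u v.

Definition equivalent (R : realType) (n d : nat) (I : dKP R n d)
    (V : finType) (G : sgraph V) : Prop :=
  exists f : 'I_n -> V,
    bijective f /\
    forall A : {set 'I_n}, feasible I A <-> independent G (f @: A).

Definition property_P (R : realType) (n d : nat) (I : dKP R n d) : Prop :=
  forall A : {set 'I_n},
    (forall i j j', j \in A -> j' \in A -> j != j' ->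
       sz I i j + sz I i j' <= cap I i) ->
    forall i, \sum_(j in A) sz I i j <= cap I i.

Definition Gd_adj (R : realType) (n d : nat) (I : dKP R n d) : rel 'I_n :=
  fun j j' => (j != j') && [exists i, cap I i < sz I i j + sz I i j'].

Lemma Gd_sym (R : realType) (n d : nat) (I : dKP R n d) :
  symmetric (Gd_adj I).
Proof.
move=> j j'; rewrite /Gd_adj eq_sym; congr (_ && _).
by apply: eq_existsb => i; rewrite addrC.
Qed.

Lemma Gd_irrefl (R : realType) (n d : nat) (I : dKP R n d) :
  irreflexive (Gd_adj I).
Proof. by move=> j; rewrite /Gd_adj eqxx. Qed.

Definition Gd (R : realType) (n d : nat) (I : dKP R n d) : sgraph 'I_n :=
  SGraph (Gd_sym I) (Gd_irrefl I).

Definition threshold_graph (R : realType) (V : finType) (H : sgraph V) : Prop :=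
  exists (w : V -> R) (T : R),
    [/\ forall v, 0 <= w v, 0 <= T &
        forall U : {set V}, independent H U <-> \sum_(v in U) w v <= T].

Definition d_threshold (R : realType) (d : nat) (V : finType) (G : sgraph V) :
    Prop :=
  exists2 k : nat, (k <= d)%N &
  exists2 H : 'I_k -> sgraph V, (forall i, threshold_graph R (H i)) &
    forall u v, adj G u v <-> exists i, adj (H i) u v.

(* Main.v *)
Require Import Defs.
From mathcomp Require Import all_boot all_order all_algebra.
From mathcomp Require Import reals.
From mathcomp Require Import zify lra.

Set Implicit Arguments.
Unset Strict Implicit.
Unset Printing Implicit Defensive.

Import Order.TTheory GRing.Theory Num.Theory.

Local Open Scope ring_scope.

(** An equivalent graph is determined by the feasible pairs, which gives
    (1) => (2) => (3).  The work is in (3) => (4): [Gd I] is the union over the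
    dimensions [i] of the graphs joining [j] and [j'] when
    [cap I i < sz I i j + sz I i j'].  The sizes and the capacity of dimension
    [i] alone need not witness that such a graph is threshold (three items of
    size 1 and capacity 2), so new weights are built.  The light vertices
    ([s v + s v <= c]) are pairwise non-adjacent and the heavy ones form a
    clique.  Light vertices get weights growing so fast with [s] that each
    exceeds the sum of all lighter ones; a heavy vertex gets the threshold
    minus the total weight of its light non-neighbours. *)

Section SumGraph.

Variables (R : realType) (V : finType) (s : V -> R) (c : R).

Definition sum_adj : rel V := fun u v => (u != v) && (c < s u + s v).

Lemma sum_adj_sym : symmetric sum_adj.
Proof. by move=> u v; rewrite /sum_adj eq_sym addrC. Qed.

Lemma sum_adj_irrefl : irreflexive sum_adj.
Proof. by move=> u; rewrite /sum_adj eqxx. Qed.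

Definition sum_graph : sgraph V := SGraph sum_adj_sym sum_adj_irrefl.

Definition light (v : V) : bool := s v + s v <= c.

(** The exponent is the rank of [s v], so vertices with equal [s] share a weight; the base exceeds
    the number of terms in any sum over [V]. *)
Definition light_weight (v : V) : nat :=
  (#|V|.+1 ^ #|[set u | (s u < s v)%R]|)%N.

Definition nonnbr_weight (h : V) : nat :=
  (\sum_(u | light u && (s h + s u <= c)%R) light_weight u)%N.

Definition threshold : nat := (\sum_(u | light u) light_weight u)%N.*2.+1.

Definition weight (v : V) : nat :=
  if light v then light_weight v else (threshold - nonnbr_weight v)%N.

Lemma light_weight_dominates (P : pred V) (v : V) :
  (forall u, P u -> s u < s v) ->
  (\sum_(u | P u) light_weight u < light_weight v)%N.
Proof.
move=> Plt; have [u0 Pu0|P0] := pickP P; last first.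
  by rewrite big_pred0 // expn_gt0.
rewrite {2}/light_weight; set r := #|_|.
have r_gt0 : (0 < r)%N by apply/card_gt0P; exists u0; rewrite inE Plt.
apply: (@leq_ltn_trans (#|V| * #|V|.+1 ^ r.-1)%N); last first.
  by rewrite -{2}(prednK r_gt0) expnS ltn_pmul2r ?expn_gt0.
(* Each [u] in [P] has rank below that of [v], hence at most [r.-1]. *)
apply: (@leq_trans (\sum_(u | P u) #|V|.+1 ^ r.-1)%N).
  apply: leq_sum => u Pu; rewrite leq_pexp2l // -ltnS prednK //.
  apply: proper_card; apply/properP; split.
    apply/subsetP => x; rewrite !inE => xu; exact: lt_trans xu (Plt u Pu).
  by exists u; rewrite !inE ?ltxx ?Plt.
by rewrite sum_nat_const leq_mul2r max_card orbT.
Qed.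

(** Makes the truncated subtraction in [weight] exact and puts every heavy vertex above half of
    [threshold], so two heavy vertices together exceed it. *)
Lemma nonnbr_weight_lt (h : V) : ((nonnbr_weight h).*2 < threshold)%N.
Proof.
rewrite ltnS leq_double /nonnbr_weight big_mkcondr /=.
by apply: leq_sum => u _; case: ifP.
Qed.

Lemma weight_heavy_light (h l : V) :
  ~~ light h -> light l -> c < s h + s l ->
  (threshold < weight h + weight l)%N.
Proof.
move=> heavy_h light_l hl; have := nonnbr_weight_lt h.
rewrite /weight (negbTE heavy_h) light_l.
(* A light non-neighbour [u] of [h] has [s u <= c - s h < s l], so [l] outweighs all of them
   together. *)
have : (nonnbr_weight h < light_weight l)%N.
  by apply: light_weight_dominates => u /andP[_ hu]; lra.
lia.
Qed.

Lemma weight_edge (u v : V) :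
  sum_adj u v -> (threshold < weight u + weight v)%N.
Proof.
case/andP => _ uv.
case: (boolP (light u)) (boolP (light v)) => lu [] lv.
- by move: lu lv; rewrite /light => lu lv; lra.
- by rewrite addnC weight_heavy_light // addrC.
- exact: weight_heavy_light.
- have := nonnbr_weight_lt u; have := nonnbr_weight_lt v.
  by rewrite /weight (negbTE lu) (negbTE lv); lia.
Qed.

Lemma weight_independent (U : {set V}) :
  independent sum_graph U <-> (\sum_(v in U) weight v <= threshold)%N.
Proof.
split=> [indU|leT u v uU vU]; last first.
  apply/negP => uv; have := weight_edge uv; rewrite ltnNge => /negP[].
  apply: leq_trans leT; rewrite (bigD1 u) //= (bigD1 v) /=; first by lia.
  by rewrite vU; case/andP: uv => uv _; rewrite eq_sym.
(* If [U] has a heavy vertex [h], all others are light non-neighbours of [h], and their weight fits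
   in the amount subtracted in [weight h]. *)
have [h /andP[hU heavy_h]|all_light] := pickP [pred h in U | ~~ light h].
  have nonadj u : u \in U -> u != h -> s h + s u <= c.
    move=> uU uh; move: (indU h u hU uU).
    by rewrite /= /sum_adj eq_sym uh /= -leNgt.
  have lightU u : u \in U -> u != h -> light u.
    move=> uU uh; move: heavy_h (nonadj u uU uh).
    rewrite /light -ltNge; lra.
  rewrite (bigD1 h) //= {1}/weight (negbTE heavy_h).
  suff : (\sum_(u in U | u != h) weight u <= nonnbr_weight h)%N.
    by have := nonnbr_weight_lt h; lia.
  rewrite /nonnbr_weight big_mkcond [leqRHS]big_mkcond /=.
  apply: leq_sum => u _; case: ifP => // /andP[uU uh].
  by rewrite /weight lightU ?nonadj.
apply: (@leq_trans (\sum_(u | light u) light_weight u)%N); last first.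
  by rewrite /threshold; lia.
rewrite big_mkcond [leqRHS]big_mkcond /=.
apply: leq_sum => u _; case: ifP => // uU.
have /negbFE light_u : ~~ light u = false by have := all_light u; rewrite /= uU.
by rewrite /weight light_u.
Qed.

Lemma sum_graph_threshold : threshold_graph R sum_graph.
Proof.
exists (fun v => (weight v)%:R), threshold%:R; split=> // U.
by rewrite -natr_sum ler_nat; exact: weight_independent.
Qed.

End SumGraph.

Lemma Gd_d_threshold (R : realType) (n d : nat) (I : dKP R n d) :
  d_threshold R d (Gd I).
Proof.
exists d => //; exists (fun i => sum_graph (sz I i) (cap I i)).
  by move=> i; exact: sum_graph_threshold.
move=> u v; split=> [/andP[uv /existsP[i lt_i]]|[i /andP[uv lt_i]]].
  by exists i; apply/andP.
by apply/andP; split=> //; apply/existsP; exists i.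
Qed.

Lemma feasible_pair (R : realType) (n d : nat) (I : dKP R n d)
    (A : {set 'I_n}) (i : 'I_d) (j j' : 'I_n) :
  feasible I A -> j \in A -> j' \in A -> j != j' ->
  sz I i j + sz I i j' <= cap I i.
Proof.
move=> feasA jA j'A jj'; apply: le_trans (feasA i).
rewrite (bigD1 j) //= (bigD1 j') /=; last by rewrite j'A eq_sym.
by rewrite addrA lerDl sumr_ge0 // => k _; exact: sz_ge0.
Qed.

(** Independence is decided on pairs, and a pair of items that fits in every dimension is a feasible
    set, hence has non-adjacent images. *)
Lemma equivalent_property_P (R : realType) (n d : nat) (I : dKP R n d)
    (V : finType) (G : sgraph V) :
  equivalent I G -> property_P I.
Proof.
move=> [f [_ eqf]] A pairA; apply/eqf.
move=> _ _ /imsetP[j jA ->] /imsetP[j' j'A ->].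
have [->|jj'] := eqVneq j j'; first by rewrite adj_irrefl.
have /eqf indp : feasible I [set j; j'].
  move=> i; rewrite big_setU1 ?inE //= big_set1; exact: pairA.
by apply: indp; apply: imset_f; rewrite !inE eqxx ?orbT.
Qed.

Lemma property_P_equivalent_Gd (R : realType) (n d : nat) (I : dKP R n d) :
  property_P I -> equivalent I (Gd I).
Proof.
move=> PI; exists id; split; first by exists id.
move=> A; rewrite imset_id; split=> [feasA j j' jA j'A|indA].
  rewrite negb_and negbK; have [//|jj' /=] := eqVneq j j'.
  by apply/existsPn => i; rewrite -leNgt; exact: feasible_pair jj'.
apply: PI => i j j' jA j'A jj'; have := indA j j' jA j'A.
by rewrite /= /Gd_adj jj' => /existsPn/(_ i); rewrite -leNgt.
Qed.

Theorem theorem4p17 (R : realType) (n d : nat) (hd : (0 < d)%N)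
    (I : dKP R n d) :
  [<-> exists (V : finType) (G : sgraph V), equivalent I G;
       property_P I;
       equivalent I (Gd I);
       exists (V : finType) (G : sgraph V),
         d_threshold R d G /\ equivalent I G].
Proof.
tfae.
- by move=> [V [G]]; exact: equivalent_property_P.
- exact: property_P_equivalent_Gd.
- by move=> eqG; exists 'I_n, (Gd I); split=> //; exact: Gd_d_threshold.
- by move=> [V [G [_ eqG]]]; exists V, G.
Qed.
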